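(* The class of congruence lattices $\mathrm{Con}\,\mathbf{A}$, where $\mathbf{A}$ ranges over the variety $\mathcal{I}$ of implicator groupoids, does not satisfy any non-trivial lattice identity. In particular, the variety $\mathcal{I}$ is neither congruence-distributive nor congruence-modular.
   Context: An implicator groupoid is an algebra $\mathbf A = \langle A, \to, 0 \rangle$, with $\to$ binary and $0$ a constant, which, writing $x' := x \to 0$, satisfies the identities (I) $(x \to y) \to z \approx [(z' \to x) \to (y \to z)']'$ and (I$_0$) $0'' \approx 0$. The variety of implicator groupoids is denoted $\mathcal{I}$. A lattice identity is non-trivial if it fails in some lattice. *)

(* Defs.v *)
From HB Require Import structures.
From Stdlib Require Import RelationClasses.
From mathcomp Require Import all_boot all_order.
From mathcomp Require Import boolp.

Set Implicit Arguments.
Unset Strict Implicit.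
Unset Printing Implicit Defensive.

Import Order.LTheory.
Local Open Scope order_scope.

HB.mixin Record isImplicatorGroupoid (A : Type) := {
  imp : A -> A -> A;
  zero : A;
  imp_axI : forall x y z : A,
    let neg u := imp u zero in
    imp (imp x y) z = neg (imp (imp (neg z) x) (neg (imp y z)));
  imp_axI0 : imp (imp zero zero) zero = zero;
}.

#[short(type="implicatorGroupoidType")]
HB.structure Definition ImplicatorGroupoid := { A of isImplicatorGroupoid A }.

(* Compatibility with the constant 0 is reflexivity. *)
Record Con (A : implicatorGroupoidType) := MkCon {
  con_rel :> A -> A -> Prop;
  con_equiv : Equivalence con_rel;
  con_imp : forall x x' y y' : A,
    con_rel x x' -> con_rel y y' -> con_rel (imp x y) (imp x' y');
}.

Section ConLattice.
Variable A : implicatorGroupoidType.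
Implicit Types r s t : Con A.

Lemma con_ext r s : (forall x y, r x y <-> s x y) -> r = s.
Proof.
case: r s => [r re ri] [s se si] /= /predeq2P rs.
by case: s / rs se si => se si; congr MkCon; apply: Prop_irrelevance.
Qed.

HB.instance Definition _ := gen_eqMixin (Con A).
HB.instance Definition _ := gen_choiceMixin (Con A).

Definition con_le r s : bool := `[< forall x y, r x y -> s x y >].

Lemma con_le_refl : reflexive con_le.
Proof. by move=> r; apply/asboolP. Qed.

Lemma con_le_anti : antisymmetric con_le.
Proof.
move=> r s /andP[/asboolP rs /asboolP sr].
by apply: con_ext => x y; split; [apply: rs | apply: sr].
Qed.

Lemma con_le_trans : transitive con_le.
Proof.
move=> s r t /asboolP rs /asboolP st; apply/asboolP => x y rxy.
exact/st/rs.
Qed.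

Definition con_meet_rel r s (x y : A) : Prop := r x y /\ s x y.

Fact con_meet_equiv r s : Equivalence (con_meet_rel r s).
Proof.
have [rr rs rt] := con_equiv r; have [sr ss st] := con_equiv s.
split.
- by move=> x; split; [apply: rr | apply: sr].
- by move=> x y [? ?]; split; [apply: rs | apply: ss].
- by move=> x y z [? ?] [? ?]; split; [apply: (rt x y) | apply: (st x y)].
Qed.

Fact con_meet_imp r s (x x' y y' : A) :
  con_meet_rel r s x x' -> con_meet_rel r s y y' ->
  con_meet_rel r s (imp x y) (imp x' y').
Proof. by move=> [? ?] [? ?]; split; apply: con_imp. Qed.

Definition con_meet r s : Con A :=
  MkCon (con_meet_equiv r s) (@con_meet_imp r s).

Definition con_join_rel r s (x y : A) : Prop :=
  forall t, (forall u v, r u v -> t u v) -> (forall u v, s u v -> t u v) ->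
  t x y.

Fact con_join_equiv r s : Equivalence (con_join_rel r s).
Proof.
split.
- by move=> x t _ _; have [tr _ _] := con_equiv t; apply: tr.
- move=> x y xy t rt st; have [_ ts _] := con_equiv t.
  exact/ts/xy.
- move=> x y z xy yz t rt st; have [_ _ tt] := con_equiv t.
  by apply: (tt x y z); [apply: xy | apply: yz].
Qed.

Fact con_join_imp r s (x x' y y' : A) :
  con_join_rel r s x x' -> con_join_rel r s y y' ->
  con_join_rel r s (imp x y) (imp x' y').
Proof. by move=> xx yy t rt st; apply: con_imp; [apply: xx | apply: yy]. Qed.

Definition con_join r s : Con A :=
  MkCon (con_join_equiv r s) (@con_join_imp r s).

Lemma con_leI r s t : con_le r (con_meet s t) = con_le r s && con_le r t.
Proof.
apply/asboolP/andP => [rst|[/asboolP rs /asboolP rt] x y rxy].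
  by split; apply/asboolP => x y /rst[].
by split; [apply: rs | apply: rt].
Qed.

Lemma con_leU r s t : con_le (con_join r s) t = con_le r t && con_le s t.
Proof.
apply/asboolP/andP => [rst|[/asboolP rt /asboolP st] x y]; last exact.
by split; apply/asboolP => x y xy; apply: rst => u ru su; [apply: ru|apply: su].
Qed.

Fact con_display : Order.disp_t. Proof. exact: Order.Disp tt tt. Qed.

HB.instance Definition _ := Order.Le_isPOrder.Build con_display (Con A)
  con_le_refl con_le_anti con_le_trans.
HB.instance Definition _ :=
  Order.POrder_isMeetSemilattice.Build con_display (Con A) con_leI.
HB.instance Definition _ :=
  Order.POrder_isJoinSemilattice.Build con_display (Con A) con_leU.

End ConLattice.

Inductive lattice_term : Type :=
  | LVar of nat
  | LMeet of lattice_term & lattice_term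
  | LJoin of lattice_term & lattice_term.

Fixpoint lattice_eval d (L : latticeType d) (v : nat -> L) (p : lattice_term)
    : L :=
  match p with
  | LVar i => v i
  | LMeet p1 p2 => lattice_eval v p1 `&` lattice_eval v p2
  | LJoin p1 p2 => lattice_eval v p1 `|` lattice_eval v p2
  end.

Definition satisfies_identity d (L : latticeType d) (p q : lattice_term) : Prop :=
  forall v : nat -> L, lattice_eval v p = lattice_eval v q.

Definition nontrivial_identity (p q : lattice_term) : Prop :=
  exists (d : Order.disp_t) (L : latticeType d), ~ satisfies_identity L p q.

Definition distributive_lattice d (L : latticeType d) : Prop :=
  left_distributive (@Order.meet d L) (@Order.join d L).

Definition modular_lattice d (L : latticeType d) : Prop :=
  forall x y z : L, x <= z -> x `|` (y `&` z) = (x `|` y) `&` z.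

(* Main.v *)
Require Import Defs.
From mathcomp Require Import all_boot all_order.
From HB Require Import structures.
From Stdlib Require Import RelationClasses.
From mathcomp Require Import boolp.

(** The operation [x -> y := 0] turns every pointed set into an implicator
    groupoid, and all equivalence relations on it are congruences.  So the
    congruence lattices of implicator groupoids include all lattices of
    equivalence relations, and the theorem comes down to Whitman's theorem in
    the form needed for identities: a lattice identity that holds in all
    lattices of equivalence relations holds in every lattice [L]
    ([identity_transfer]).

    The proof follows Jonsson.  Instead of an [L]-valued distance on a set, a
    space carries the relations [near c], read as: the distance is at most [c].
    Each [near c] is an equivalence, and [c |-> near c] preserves meets and
    satisfies half of the preservation of joins.  Hence a term evaluated at the
    relations [near (v i)] always lies below [near] of its value in [L]
    ([eval_sub_near]).  Conversely, a pair at distance at most [a `|` b] can be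
    linked, in a space with three more points, by a path with steps of lengths
    [a], [b], [a], [b].  Inserting finitely many such paths makes a given pair
    that is near at the value of a term belong to the relation that the term
    denotes ([near_realized]), without changing the old distances.  Apply this
    to two points at distance exactly the value of [p]: if [p] and [q] denote
    the same relation, the distance is also at most the value of [q], and so
    the value of [p] is at most that of [q].

    Non-modularity is visible on a four-element set, and a distributive lattice
    is modular. *)

Set Implicit Arguments.
Unset Strict Implicit.
Unset Printing Implicit Defensive.

Import Order.LTheory.
Local Open Scope order_scope.

(** * Null groupoids and their congruences *)

(** The base point is an argument so that it can be read off the type when the
    algebra structure is inferred. *)
Definition null_groupoid (X : Type) (o : X) : Type := X.

HB.instance Definition _ (X : Type) (o : X) :=
  @isImplicatorGroupoid.Build (null_groupoid o) (fun _ _ => o) o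
    (fun _ _ _ => erefl) erefl.

Definition null_con (X : Type) (o : X) (R : X -> X -> Prop)
    (eqR : Equivalence R) : Con (null_groupoid o) :=
  @MkCon (null_groupoid o) R eqR
    (fun _ _ _ _ _ _ => @Equivalence_Reflexive X R eqR o).

Lemma con_leP (A : implicatorGroupoidType) (r s : Con A) :
  reflect (forall x y, r x y -> s x y) (r <= s).
Proof. exact: asboolP. Qed.

Lemma meet_conE (A : implicatorGroupoidType) (r s : Con A) x y :
  (r `&` s) x y <-> r x y /\ s x y.
Proof. by []. Qed.

Lemma con_joinl (A : implicatorGroupoidType) (r s : Con A) x y :
  r x y -> (r `|` s) x y.
Proof. by move: x y; apply/con_leP/leUl. Qed.

Lemma con_joinr (A : implicatorGroupoidType) (r s : Con A) x y :
  s x y -> (r `|` s) x y.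
Proof. by move: x y; apply/con_leP/leUr. Qed.

(** * Spaces with distances in a lattice *)

(** The distance from [x] to [y] is encoded by the filter of all [c] with
    [near c x y].  For [x = y] this filter is all of [L], so [L] need not have a
    least element to serve as the distance from a point to itself. *)
Record space d (L : latticeType d) := Space {
  point :> Type;
  base : point;
  near : L -> point -> point -> Prop;
  near_equiv : forall c, Equivalence (near c);
  near_le : forall c e x y, c <= e -> near c x y -> near e x y;
  near_meet : forall c e x y, near c x y -> near e x y -> near (c `&` e) x y
}.

Section Spaces.
Context {d : Order.disp_t} {L : latticeType d}.
Implicit Types (S T : space L) (a b c e : L) (p q : lattice_term).

Definition near_con S c : Con (null_groupoid (base S)) :=
  null_con (base S) (near_equiv S c).

Definition eval_con S (v : nat -> L) p : Con (null_groupoid (base S)) :=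
  lattice_eval (fun i => near_con S (v i)) p.

Lemma eval_sub_near S v p : eval_con S v p <= near_con S (lattice_eval v p).
Proof.
rewrite /eval_con; elim: p => [i|p IHp q IHq|p IHp q IHq] //=.
  apply/con_leP => x y /meet_conE[xy1 xy2].
  by apply: near_meet; [move/con_leP: IHp; apply | move/con_leP: IHq; apply].
rewrite leUx; apply/andP; split; [apply: le_trans IHp _|apply: le_trans IHq _].
  by apply/con_leP => x y; apply/near_le/leUl.
by apply/con_leP => x y; apply/near_le/leUr.
Qed.

(** * Embeddings of spaces *)

Definition embedding S T (f : S -> T) : Prop :=
  forall c x y, near c x y <-> near c (f x) (f y).

Lemma embedding_comp S T (U : space L) (g : T -> U) (f : S -> T) :
  embedding g -> embedding f -> embedding (g \o f).
Proof. by move=> gE fE c x y; rewrite fE gE. Qed.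

Lemma preim_equiv (X Y : Type) (f : X -> Y) (R : Y -> Y -> Prop) :
  Equivalence R -> Equivalence (fun x y => R (f x) (f y)).
Proof.
case=> Rr Rs Rt; split=> [x|x y|x y z]; [exact: Rr|exact: Rs|exact: Rt].
Qed.

(** For a join, pull the relation denoted on [T] back along [f]: the result is
    an equivalence on [S] above both joined relations, hence above their join. *)
Lemma eval_embedding S T (f : S -> T) v p x y :
  embedding f -> eval_con S v p x y -> eval_con T v p (f x) (f y).
Proof.
move=> fE; rewrite /eval_con.
elim: p x y => [i|p IHp q IHq|p IHp q IHq] x y /=.
- by move/fE.
- by case/meet_conE=> /IHp ? /IHq ?; apply/meet_conE.
- have rE := preim_equiv f (con_equiv (eval_con T v (LJoin p q))).
  move=> /(_ (null_con (base S) rE)); apply=> u w.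
    by move/IHp; apply: con_joinl.
  by move/IHq; apply: con_joinr.
Qed.

End Spaces.

(** * Inserting a path *)

Inductive with_path (X : Type) : Type := Old of X | Z1 | Z2 | Z3.
Arguments Z1 {X}.
Arguments Z2 {X}.
Arguments Z3 {X}.

Section InsertPath.
Context {d : Order.disp_t} {L : latticeType d} {S : space L}.
Variables (a b : L) (x y : S).
Hypothesis xy : near (a `|` b) x y.
Implicit Types (c e : L) (u v w : with_path S).

(** The new distances are those of shortest routes along the path
    [x, Z1, Z2, Z3, y] with steps [a], [b], [a], [b].  An old point reaches
    [Z2] through [x]; going through [y] costs the same, because [x] and [y] are
    at distance at most [a `|` b]. *)
Definition path_near c u v : Prop :=
  match u, v with
  | Old s, Old t => near c s t
  | Old s, Z1 | Z1, Old s => near c x s /\ a <= c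
  | Old s, Z2 | Z2, Old s => near c x s /\ (a <= c /\ b <= c)
  | Old s, Z3 | Z3, Old s => near c y s /\ b <= c
  | Z1, Z2 | Z2, Z1 => b <= c
  | Z2, Z3 | Z3, Z2 => a <= c
  | Z1, Z3 | Z3, Z1 => a <= c /\ b <= c
  | Z1, Z1 | Z2, Z2 | Z3, Z3 => True
  end.

Lemma path_near_equiv c : Equivalence (path_near c).
Proof.
have [nr ns nt] := near_equiv S c.
have nxy : a <= c -> b <= c -> near c x y.
  by move=> ac bc; apply: near_le xy; rewrite leUx ac.
split.
- by case=> [s|||] //=; apply: nr.
- by case=> [s|||] [t|||] //=; apply: ns.
- have nyx ac bc := ns _ _ (nxy ac bc).
  have nxx := nr x; have nyy := nr y.
  case=> [s|||] [t|||] [r|||] //=; intuition eauto.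
Qed.

Lemma path_near_le c e u v : c <= e -> path_near c u v -> path_near e u v.
Proof.
move=> ce; have ne := near_le ce; have le_ce f := @le_trans _ _ c f e ^~ ce.
by case: u v => [s|||] [t|||] //=; intuition eauto.
Qed.

Lemma path_near_meet c e u v :
  path_near c u v -> path_near e u v -> path_near (c `&` e) u v.
Proof.
have nm := @near_meet _ _ S c e.
have le_meet f : f <= c -> f <= e -> f <= c `&` e by rewrite lexI => ->.
by case: u v => [s|||] [t|||] //=; intuition eauto.
Qed.

Definition path_space : space L :=
  Space (Old (base S)) path_near_equiv path_near_le path_near_meet.

Lemma Old_embedding : @embedding _ _ S path_space (@Old S).
Proof. by []. Qed.

Lemma path_spaceP :
  [/\ @near _ _ path_space a (Old x) Z1, @near _ _ path_space b Z1 Z2,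
      @near _ _ path_space a Z2 Z3 & @near _ _ path_space b Z3 (Old y)].
Proof.
by split=> //=; split=> //; apply: (@Equivalence_Reflexive _ _ (near_equiv _ _)).
Qed.

End InsertPath.

(** * Transfer of identities *)

Section Transfer.
Context {d : Order.disp_t} {L : latticeType d}.
Implicit Types (S T : space L) (p q : lattice_term).

(** For a join, each of the four steps of an inserted path is realized in turn;
    what has been realized survives further extensions by [eval_embedding]. *)
Lemma near_realized v p S (x y : S) : near (lattice_eval v p) x y ->
  exists (T : space L) (f : S -> T),
    embedding f /\ eval_con T v p (f x) (f y).
Proof.
elim: p S x y => [i|p IHp q IHq|p IHp q IHq] S x y /= xy.
- by exists S, id.
- have [T [f [fE xyp]]] := IHp _ _ _ (near_le (leIl _ _) xy).
  have [U [g [gE xyq]]] := IHq _ _ _ ((fE _ _ _).1 (near_le (leIr _ _) xy)).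
  exists U, (g \o f); split; first exact: embedding_comp.
  by split; [apply: eval_embedding gE xyp | apply: xyq].
have [s1 s2 s3 s4] := path_spaceP xy.
have [T1 [f1 [f1E r1]]] := IHp _ _ _ s1.
have [T2 [f2 [f2E r2]]] := IHq _ _ _ ((f1E _ _ _).1 s2).
have f21E := embedding_comp f2E f1E.
have [T3 [f3 [f3E r3]]] := IHp _ _ _ ((f21E _ _ _).1 s3).
have f321E := embedding_comp f3E f21E.
have [T4 [f4 [f4E r4]]] := IHq _ _ _ ((f321E _ _ _).1 s4).
have f43E := embedding_comp f4E f3E.
exists T4, (f4 \o (f3 \o (f2 \o f1)) \o @Old S); split.
  exact: embedding_comp (embedding_comp f4E f321E) (Old_embedding xy).
have pr u w : eval_con T4 v p u w -> eval_con T4 v (LJoin p q) u w.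
  exact: con_joinl.
have qr u w : eval_con T4 v q u w -> eval_con T4 v (LJoin p q) u w.
  exact: con_joinr.
have [_ _ rt] := con_equiv (eval_con T4 v (LJoin p q)).
apply: (rt _ _ _ (pr _ _ (eval_embedding (embedding_comp f43E f2E) r1))).
apply: (rt _ _ _ (qr _ _ (eval_embedding f43E r2))).
exact: rt (pr _ _ (eval_embedding f4E r3)) (qr _ _ r4).
Qed.

Section TwoPoints.
Variable m : L.

Definition two_near (c : L) (x y : bool) : Prop := x = y \/ m <= c.

Lemma two_near_equiv c : Equivalence (two_near c).
Proof.
split=> [x|x y|x y z]; first by left.
  by case=> [->|]; [left | right].
by case=> [->|? _] //; right.
Qed.

Lemma two_near_le c e x y : c <= e -> two_near c x y -> two_near e x y.
Proof. by move=> ce [->|mc]; [left | right; apply: le_trans ce]. Qed.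

Lemma two_near_meet c e x y :
  two_near c x y -> two_near e x y -> two_near (c `&` e) x y.
Proof. by case=> [->|mc] [?|me]; [left..|right; rewrite lexI mc]. Qed.

Definition two_space : space L :=
  Space true two_near_equiv two_near_le two_near_meet.

End TwoPoints.

Lemma eval_le_transfer p q (v : nat -> L) :
  (forall A : implicatorGroupoidType, satisfies_identity (Con A) p q) ->
  lattice_eval v p <= lattice_eval v q.
Proof.
move=> pq; pose S := two_space (lattice_eval v p).
have xy : @near _ _ S (lattice_eval v p) true false by right.
have [T [f [fE]]] := near_realized xy.
rewrite /eval_con pq => /(con_leP _ _ (eval_sub_near T v q)).
by move/fE; case.
Qed.

Lemma identity_transfer p q :
  (forall A : implicatorGroupoidType, satisfies_identity (Con A) p q) ->
  satisfies_identity L p q.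
Proof.
move=> pq v; apply: le_anti; rewrite !eval_le_transfer //.
by move=> A w; rewrite pq.
Qed.

End Transfer.

(** * Modularity and distributivity *)

Lemma distributive_modular d (L : latticeType d) :
  distributive_lattice L -> modular_lattice L.
Proof. by move=> dL x y z /meet_idPl xz; rewrite dL xz. Qed.

(** On the square, take for [y] and [z] the kernels of the two projections and
    for [x] the equivalence that collapses just one class of [z].  Then
    [y `&` z] is equality, whereas [x `|` y] relates all points. *)
Lemma square_not_modular :
  ~ modular_lattice (Con (null_groupoid (true, true))).
Proof.
pose Rx (u w : bool * bool) := u = w \/ u.1 /\ w.1.
have eqx : Equivalence Rx.
  split=> [u|u w|u w t]; first by left.
    by case=> [->|[]]; [left | right].
  by case=> [->|[u1 w1]] // [<-|[_ t1]]; right.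
have eqE (X Y : Type) (f : X -> Y) : Equivalence (fun u w => f u = f w).
  exact: preim_equiv.
pose x := null_con (true, true) eqx.
pose y := null_con (true, true) (eqE _ _ snd).
pose z := null_con (true, true) (eqE _ _ fst).
have xz : x <= z.
  by apply/con_leP => -[u1 u2] [w1 w2] [[-> _]|/= [-> ->]].
move=> /(_ x y z xz) modE.
have yzx : y `&` z <= x.
  by apply/con_leP => -[u1 u2] [w1 w2] /meet_conE[/= -> ->]; left.
have : ((x `|` y) `&` z) (false, false) (false, true).
  apply/meet_conE; split=> //.
  have [_ _ rt] := con_equiv (x `|` y).
  have yr u w : y u w -> (x `|` y) u w by apply: con_joinr.
  have xr u w : x u w -> (x `|` y) u w by apply: con_joinl.
  apply: (rt _ (true, false)); first exact: yr.
  by apply: (rt _ (true, true)); [apply: xr; right | apply: yr].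
rewrite -modE; have/join_idPl -> := yzx.
by case=> [|[]].
Qed.

Theorem corollary10p5 :
  (forall p q : lattice_term, nontrivial_identity p q ->
     ~ (forall A : implicatorGroupoidType, satisfies_identity (Con A) p q)) /\
  ~ (forall A : implicatorGroupoidType, distributive_lattice (Con A)) /\
  ~ (forall A : implicatorGroupoidType, modular_lattice (Con A)).
Proof.
split; [|split].
- by move=> p q [d [L pqL]] pq; apply/pqL/identity_transfer.
- by move=> dA; apply/square_not_modular/distributive_modular/dA.
- by move=> mA; apply/square_not_modular/mA.
Qed.
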